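(* $\mathfrak{cp}(\mathsf{meager}\setminus\{\emptyset\},\subseteq)=\operatorname{cof}(\mathsf{meager})$.
   Context: $\mathsf{meager}$ is the ideal of meager subsets of $2^\omega$, ordered by inclusion. For a poset $(P,\le)$, $F\subseteq P$ is a comparable family if for every $p\in P$ there is $q\in F$ with $p\le q$ or $q\le p$; $\mathfrak{cp}(P)$ is the minimal size of a comparable family. $\operatorname{cof}(\mathsf{meager})$ is the minimal size of a family $\mathcal{F}\subseteq\mathsf{meager}$ such that every meager set is contained in some member of $\mathcal{F}$. *)

(* Defs.v *)
From HB Require Import structures.
From mathcomp Require Import all_boot all_order all_algebra.
From mathcomp Require Import all_classical all_reals all_analysis.
Set Implicit Arguments. Unset Strict Implicit. Unset Printing Implicit Defensive.
Local Open Scope classical_set_scope.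

(* 2^omega is mathcomp-analysis's [cantor_space] (nat -> bool, product topology). *)

Definition nowhere_dense (A : set cantor_space) : Prop :=
  interior (closure A) = set0.

Definition meager (A : set cantor_space) : Prop :=
  exists F : nat -> set cantor_space,
    (forall n, nowhere_dense (F n)) /\ A `<=` \bigcup_n F n.

Definition meager_nonempty : set (set cantor_space) :=
  [set A | meager A /\ A <> set0].

Definition comparable_family (P F : set (set cantor_space)) : Prop :=
  F `<=` P /\
  forall p, P p -> exists2 q, F q & (p `<=` q \/ q `<=` p).

Definition cofinal_meager (F : set (set cantor_space)) : Prop :=
  F `<=` meager /\ forall M, meager M -> exists2 q, F q & M `<=` q.

(* Main.v *)
Require Import Defs.
From HB Require Import structures.
From mathcomp Require Import all_boot all_order all_algebra.
From mathcomp Require Import all_classical all_reals all_analysis.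
Set Implicit Arguments. Unset Strict Implicit.
Local Open Scope classical_set_scope.
Local Open Scope card_scope.

(* Let F be comparable (the other inequality is immediate).  If
   |F| >= 2^omega, the meager F_sigma sets already form a small enough cofinal
   family.  Otherwise identify 2^omega with 2^omega x 2^omega (even and odd
   coordinates) and attach to each q in F a meager set E q such that, for
   x outside E q, the complement of the section q_x contains 2^omega many points
   (Kuratowski-Ulam).  The sets E q are cofinal: if M were contained in none of
   them, pick x_q in q and, since |F| < 2^omega, a_q in (M x 2^omega) \ q
   different from all the x_q'.  Then {a_q : q in F} is meager, and it is
   comparable with no q in F, as a_q is not in q and x_q is not among the a's. *)

(** * Cylinders and nowhere dense sets *)

Definition agree (n : nat) (x y : cantor_space) : Prop :=
  forall i, (i < n)%N -> y i = x i.

Lemma leq_agree m n x y : (m <= n)%N -> agree n x y -> agree m x y.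
Proof. by move=> mn xy i im; rewrite xy// (leq_trans im). Qed.

Lemma agree_trans m n x y z :
  (m <= n)%N -> agree m x y -> agree n y z -> agree m x z.
Proof. by move=> mn xy yz i im; rewrite yz ?xy// (leq_trans im). Qed.

Lemma nbhs_agree n (x : cantor_space) : nbhs x (agree n x).
Proof.
elim: n => [|n IH]; first by apply: filterS filterT => y _ i.
have xn : nbhs x [set y : cantor_space | y n = x n].
  have /(_ x [set b | b = x n]) := @proj_continuous nat (fun=> bool) n.
  apply; exact: discrete_set1.
apply: filterS (filterI IH xn) => y [xy yn] i.
by rewrite ltnS leq_eqVlt => /predU1P[->//|/xy].
Qed.

Lemma nbhs_cantorP (x : cantor_space) (A : set cantor_space) :
  nbhs x A <-> exists n, agree n x `<=` A.
Proof.
split=> [xA|[n nA]]; last by apply: filterS nA _; exact: nbhs_agree.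
pose F : set_system cantor_space := [set B | exists n, agree n x `<=` B].
have FF : Filter F.
  split; first by exists 0%N.
  - move=> P Q [n nP] [m mQ]; exists (maxn n m) => y xy; split.
      by apply: nP; apply: leq_agree xy; exact: leq_maxl.
    by apply: mQ; apply: leq_agree xy; exact: leq_maxr.
  - by move=> P Q PQ [n nP]; exists n; exact: subset_trans PQ.
(* Convergence in the product topology can be tested one coordinate at a time. *)
suff : F --> x by exact.
apply/cvg_sup => i U. rewrite nbhsE => -[V [[W oW <-] Wx]] VU.
by exists i.+1 => y xy; apply: VU => /=; rewrite (_ : y i = x i)// xy.
Qed.

(** Nowhere density in terms of cylinders; [n <= m] places the cylinder around [y] inside the one
    around [x]. *)
Definition sparse (A : set cantor_space) : Prop :=
  forall x n, exists y m, [/\ (n <= m)%N, agree n x y & agree m y `<=` ~` A].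

Lemma nowhere_denseP (A : set cantor_space) : nowhere_dense A <-> sparse A.
Proof.
split=> [A0 x n|sA]; last first.
  rewrite /nowhere_dense -subset0 => x /nbhs_cantorP[n nA].
  have [y [m [nm xy mA]]] := sA x n.
  by have [z [Az yz]] := nA _ xy _ (nbhs_agree m y); exact: mA yz Az.
apply: contrapT => noy; suff : interior (closure A) x by rewrite A0.
apply/nbhs_cantorP; exists n => y xy B /nbhs_cantorP[m mB].
apply: contrapT => AB0; apply: noy; exists y, (maxn n m); split=> //.
  exact: leq_maxl.
move=> z yz Az; apply: AB0; exists z; split=> //; apply: mB.
by apply: leq_agree yz; exact: leq_maxr.
Qed.

Lemma sub_meager (A B : set cantor_space) : A `<=` B -> meager B -> meager A.
Proof. by move=> AB [F [nF BF]]; exists F; split=> //; exact: subset_trans BF. Qed.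

Lemma meager_bigcup (T : countType) (A : T -> set cantor_space) :
  (forall t, nowhere_dense (A t)) -> meager (\bigcup_t A t).
Proof.
move=> nA; exists (fun n => if unpickle n is Some t then A t else set0); split.
  move=> n; case: unpickle => [t|]; first exact: nA.
  by rewrite /nowhere_dense closure0 interior0.
by move=> x [t _ Ax]; exists (pickle t); rewrite // pickleK.
Qed.

Lemma nowhere_dense_singleton (x : cantor_space) : nowhere_dense [set x].
Proof.
apply/nowhere_denseP => y n.
(* Length [n.+1] includes one flipped bit of [x], which excludes [x]. *)
exists (fun i => if (i < n)%N then y i else ~~ x i), n.+1; split=> //.
  by move=> i ->.
by move=> z /(_ n (leqnn _)) + zx; rewrite zx ltnn; case: (x n).
Qed.

(** * Cantor space as its own square, and sections *)

Definition join (x y : cantor_space) : cantor_space :=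
  fun i => if odd i then y i./2 else x i./2.

Definition evens (z : cantor_space) : cantor_space := fun i => z i.*2.

Definition odds (z : cantor_space) : cantor_space := fun i => z i.*2.+1.

Lemma evens_join x y : evens (join x y) = x.
Proof. by apply: funext => i; rewrite /evens/join odd_double doubleK. Qed.

Lemma odds_join x y : odds (join x y) = y.
Proof. by apply: funext => i; rewrite /odds/join/= odd_double uphalf_double. Qed.

Lemma join_evens_odds z : join (evens z) (odds z) = z.
Proof.
apply: funext => i; rewrite /join/evens/odds.
by case: ifP => oi; rewrite -[in RHS](odd_double_half i) oi.
Qed.

Lemma agree_join n x x' y y' :
  agree n x x' -> agree n y y' -> agree n.*2 (join x y) (join x' y').
Proof.
move=> xx' yy' i; rewrite -ltn_half_double => ilt.
by rewrite /join xx' ?yy'.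
Qed.

Lemma agree_evens n z z' : agree n.*2 z z' -> agree n (evens z) (evens z').
Proof. by move=> zz' i ilt; rewrite /evens zz'// ltn_double. Qed.

Lemma agree_odds n z z' : agree n.*2 z z' -> agree n (odds z) (odds z').
Proof. by move=> zz' i ilt; rewrite /odds zz'// ltn_Sdouble. Qed.

Lemma leq_doubler n : (n <= n.*2)%N.
Proof. by rewrite -addnn leq_addr. Qed.

Lemma sparse_preimage_evens A : sparse A -> sparse (evens @^-1` A).
Proof.
move=> sA z n; have [x [m [nm zx mA]]] := sA (evens z) n.
exists (join x (odds z)), m.*2; split.
- exact: leq_trans (leq_doubler m).
- rewrite -{1}[z]join_evens_odds; apply: leq_agree (leq_doubler n) _.
  exact: agree_join.
- by move=> z' /agree_evens; rewrite evens_join => /mA.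
Qed.

Lemma meager_preimage_evens M : meager M -> meager (evens @^-1` M).
Proof.
move=> [F [nF MF]]; exists (fun n => evens @^-1` F n); split=> [n|z /MF//].
by apply/nowhere_denseP/sparse_preimage_evens/nowhere_denseP.
Qed.

(** Exactly the failure of [sparse] at [y], [n] for the section of [A] over [x]. *)
Definition dense_section (A : set cantor_space) (y : cantor_space) (n : nat) :
    set cantor_space :=
  [set x | forall y' m, (n <= m)%N -> agree n y y' ->
     exists2 z, agree m y' z & A (join x z)].

(** A cylinder around [w] missing [A] contains a product of two cylinders: over each [x'] in the
    first, the section of [A] misses the second. *)
Lemma sparse_dense_section A y n : sparse A -> sparse (dense_section A y n).
Proof.
move=> sA x k; have [w [m [km xyw mA]]] := sA (join x y) (maxn k n).*2.
have {km} : (maxn k n <= m)%N := leq_trans (leq_doubler _) km.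
rewrite geq_max => /andP[km nm].
exists (evens w), m; split=> //.
  rewrite -(evens_join x y); apply: leq_agree (leq_maxl k n) _.
  exact: agree_evens.
move=> x' wx' /(_ (odds w) m nm)[].
  rewrite -(odds_join x y); apply: leq_agree (leq_maxr k n) _.
  exact: agree_odds.
move=> z wz; apply: mA; rewrite -{1}(join_evens_odds w).
by apply: leq_agree (leq_doubler m) _; exact: agree_join.
Qed.

(** * Continuum many points outside a meager set and in its fibers *)

(* A Cantor scheme: between two successive choices [b n] the [n]-th step moves
   into a basic clopen set disjoint from [F n]. *)
Section perfect_scheme.
Variables (F : nat -> set cantor_space).
Variable step : nat -> cantor_space * nat -> cantor_space * nat.
Hypothesis stepP : forall n p, [/\ (p.2 <= (step n p).2)%N,
  agree p.2 p.1 (step n p).1 & agree (step n p).2 (step n p).1 `<=` ~` F n].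

Fixpoint node (b : cantor_space) (n : nat) : cantor_space * nat :=
  if n is n'.+1 then
    let q := step n' (node b n') in
    (* The extra position [q.2] records the bit [b n'], so that distinct [b] separate. *)
    ((fun i => if (i < q.2)%N then q.1 i else b n'), q.2.+1)
  else (fun=> false, 0%N).

(** Bit [i] is final at stage [i.+1], whose node has length at least [i.+1]. *)
Definition branch (b : cantor_space) : cantor_space :=
  fun i => (node b i.+1).1 i.

Lemma leq_node b n : (n <= (node b n).2)%N.
Proof.
by elim: n => //= n IH; have [+ _ _] := stepP n (node b n); exact: leq_trans.
Qed.

Lemma agree_node b n m :
  (n <= m)%N -> agree (node b n).2 (node b n).1 (node b m).1.
Proof.
move=> /subnK <-; elim: (m - n)%N => [//|k IH].
have [le_k agr_k _] := stepP (k + n) (node b (k + n)).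
have le_nk : ((node b n).2 <= (node b (k + n)).2)%N.
  elim: (k) => // j; rewrite addSn => /leq_trans; apply => /=.
  by have [+ _ _] := stepP (j + n) (node b (j + n)); exact: leqW.
apply: agree_trans le_nk IH _; rewrite addSn/= => i ilt.
by rewrite (leq_trans ilt le_k) agr_k.
Qed.

Lemma agree_branch b n : agree (node b n).2 (node b n).1 (branch b).
Proof.
move=> i ilt; rewrite /branch; have [lt|le] := leqP i.+1 n.
  by rewrite -(agree_node lt)//; exact: leq_node.
by rewrite (agree_node (ltnW le)).
Qed.

Lemma branch_avoids b n : ~ F n (branch b).
Proof.
have [_ _] := stepP n (node b n); apply => i ilt.
by have := @agree_branch b n.+1 i; rewrite /= ilt; apply; exact: leqW.
Qed.

Lemma branch_inj : injective branch.
Proof.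
move=> b b' bb'.
have eqS n : node b n = node b' n -> b n = b' n.
  (* Equal nodes place [b n] and [b' n] at the same position [k] of the two branches. *)
  move=> nn; set k := (step n (node b n)).2.
  have := @agree_branch b n.+1 k; have := @agree_branch b' n.+1 k.
  by rewrite /= -nn -/k ltnn => <-// <-//; rewrite bb'.
have eqN n : node b n = node b' n by elim: n => //= n IH; rewrite IH (eqS _ IH).
by apply: funext => n; exact/eqS/eqN.
Qed.

End perfect_scheme.

Lemma sparse_complement_perfect (F : nat -> set cantor_space) :
  (forall n, sparse (F n)) ->
  exists2 f : cantor_space -> cantor_space, injective f & forall b n, ~ F n (f b).
Proof.
move=> sF.
have /choice[g gP] (np : nat * (cantor_space * nat)) :
    exists q : cantor_space * nat, [/\ (np.2.2 <= q.2)%N,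
      agree np.2.2 np.2.1 q.1 & agree q.2 q.1 `<=` ~` F np.1].
  by have [y [m ?]] := sF np.1 np.2.1 np.2.2; exists (y, m).
have stepP n p := gP (n, p).
exists (branch (fun n p => g (n, p))).
  exact: (@branch_inj F _ stepP).
exact: (@branch_avoids F _ stepP).
Qed.

(* Quantifying over [seq bool] instead of points keeps the exceptional set a
   countable union. *)
Lemma meager_fibers (q : set cantor_space) : meager q ->
  exists2 E, meager E &
    forall x, ~ E x -> exists2 f : cantor_space -> cantor_space,
      injective f & forall b, ~ q (join x (f b)).
Proof.
move=> [F [nF qF]].
exists (\bigcup_(t : nat * seq bool * nat)
    dense_section (F t.1.1) (nth false t.1.2) t.2).
  by apply: meager_bigcup => t; apply/nowhere_denseP/sparse_dense_section/nowhere_denseP.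
move=> x Ex.
have [n y k|f f_inj fF] := @sparse_complement_perfect (fun n => join x @^-1` F n).
  (* A section that is not sparse at [y], [k] puts [x] in the exceptional set; only the first [k]
     bits of [y] matter, so padding by [false] is harmless. *)
  apply: contrapT => noy; apply: Ex; exists (n, mkseq y k, k) => //= y' m km yy'.
  apply: contrapT => noz; apply: noy; exists y', m; split=> //.
    by move=> i ik; rewrite yy'// nth_mkseq.
  by move=> z y'z Fz; apply: noz; exists z.
by exists f => // b /qF[n _]; exact: fF.
Qed.

(** * Coding meager sets by points *)

(* [c] lists the finite strings whose cylinders are removed from the [n]-th set. *)
Definition coded (c : cantor_space) (n : nat) : set cantor_space :=
  [set x | forall k, ~~ c (pickle (n, mkseq x k))].

(** Listing all cylinders disjoint from [F n] leaves its closure, which is still nowhere dense. *)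
Lemma meager_coded M : meager M ->
  exists2 c, meager (\bigcup_n coded c n) & M `<=` \bigcup_n coded c n.
Proof.
move=> [F [nF MF]].
pose c : cantor_space := fun i =>
  if @unpickle (nat * seq bool)%type i is Some (n, l)
  then `[< forall x, mkseq x (size l) = l -> ~ F n x >] else false.
have cE n y k : c (pickle (n, mkseq y k)) = `[< agree k y `<=` ~` F n >].
  rewrite /c pickleK size_mkseq; apply: asbool_equiv_eq; split=> H z yz; apply: H.
    by apply/eq_in_map => i; rewrite mem_iota => /yz.
  move=> i ik; have := congr1 (nth false ^~ i) yz.
  by rewrite !nth_mkseq.
exists c.
  apply: meager_bigcup => n; apply/nowhere_denseP => x k.
  have /nowhere_denseP/(_ x k)[y [m [km xy mF]]] := nF n.
  exists y, m; split=> // z yz /(_ m) /negP; apply.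
  rewrite cE; apply/asboolP => u zu; apply: mF.
  exact: agree_trans zu.
move=> x /MF[n _ Fx]; exists n => // k; rewrite cE; apply/asboolPn => /(_ x).
exact.
Qed.

(** Codes are points of Cantor space; the intersection with [meager] discards codes of non-meager
    unions. *)
Lemma cofinal_meager_continuum :
  exists2 G, cofinal_meager G & G #<= [set: cantor_space].
Proof.
pose U (c : cantor_space) := \bigcup_n coded c n.
exists (U @` [set: cantor_space] `&` meager).
  split=> [M []//|M /meager_coded[c mc Mc]].
  by exists (U c) => //; split=> //; exists c.
by apply: card_le_trans (card_image_le U _); apply: subset_card_le => M [].
Qed.

(* cp(meager \ {0}, ⊆) = cof(meager): each minimum is attained below by the other. *)
Theorem mainTheorem14 :
  (forall F : set (set cantor_space),
      comparable_family meager_nonempty F ->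
      exists2 G : set (set cantor_space), cofinal_meager G & G #<= F) /\
  (forall G : set (set cantor_space),
      cofinal_meager G ->
      exists2 F : set (set cantor_space),
        comparable_family meager_nonempty F & F #<= G).
Proof.
split=> [F [FP Fcomp]|G [GM Gcof]]; last first.
  exists (G `&` [set A | A <> set0]); last by apply: subset_card_le => A [].
  split=> [A [/GM]//|p [/Gcof[q Gq pq] p0]].
  exists q; last by left.
  by split=> // q0; apply: p0; rewrite -subset0 -q0.
have [cF|cF] := pselect ([set: cantor_space] #<= F).
  by have [G Gcof /card_le_trans/(_ cF)] := cofinal_meager_continuum; exists G.
have /choice[E EP] q : exists E, meager q -> meager E /\
    forall x, ~ E x -> exists2 f : cantor_space -> cantor_space,
      injective f & forall b, ~ q (join x (f b)).
  have [/meager_fibers[E mE EP]|nq] := pselect (meager q); first by exists E.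
  by exists set0.
exists (E @` F); last exact: card_image_le.
split=> [_ [q Fq <-]|M mM]; first by have [] := EP q (FP _ Fq).1.
apply: contrapT => noq.
have /choice[x xP] q : exists x, F q -> q x.
  have [/FP[_ /eqP/set0P[x qx]]|nFq] := pselect (F q); first by exists x.
  by exists point.
have /choice[a aP] q : exists a, F q -> [/\ M (evens a), ~ q a & ~ (x @` F) a].
  have [Fq|nFq] := pselect (F q); last by exists point.
  have [u Mu Eu] : exists2 u, M u & ~ E q u.
    apply: contrapT => nou; apply: noq; exists (E q); first by exists q.
    by move=> u Mu; apply: contrapT => Eu; apply: nou; exists u.
  have [_ /(_ u Eu)[f f_inj fq]] := EP q (FP _ Fq).1.
  have [b xb] : exists b, ~ (x @` F) (join u (f b)).
    (* Otherwise [join u \o f] injects Cantor space into the set of all [x q], which is no larger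
       than [F]. *)
    apply: contrapT => nob; apply: cF.
    apply: card_le_trans (card_image_le x F).
    have h_inj : injective (join u \o f).
      by move=> b b' /(congr1 odds); rewrite /= !odds_join => /f_inj.
    have /card_eqPle[_ /card_le_trans] :=
      @inj_card_eq _ _ [set: cantor_space] _ (in2W h_inj).
    apply; apply: subset_card_le => _ [b _ <-].
    by apply: contrapT => xb; apply: nob; exists b.
  by exists (join u (f b)); rewrite evens_join.
have mp : meager (a @` F).
  apply: sub_meager (meager_preimage_evens mM).
  by move=> _ [q /aP[Ma _ _] <-].
(* Some set is comparable with a singleton, so [F], and with it the set of all [a q], is
   nonempty. *)
have [q0 Fq0] : exists q, F q.
  have [|q Fq _] := Fcomp [set point]; last by exists q.
  split; last by apply/eqP/set0P; exists point.
  exists (fun=> [set point]); split=> [n|z ->]; last by exists 0%N.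
  exact: nowhere_dense_singleton.
have [|q Fq [pq|qp]] := Fcomp (a @` F).
- by split=> //; apply/eqP/set0P; exists (a q0); exists q0.
- by have [_ + _] := aP _ Fq; apply; apply: pq; exists q.
- have [q' Fq' aq'] := qp _ (xP _ Fq).
  by have [_ _] := aP _ Fq'; apply; exists q.
Qed.
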